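(* Assume the standing hypotheses (H) and (L) below. For $i=1,2$ let $u_i\in W^{1,1}(0,T;X)$, $w_i\in W^{1,1}(0,T;W)$, $x_i^0\in Z(w_i(0))$, let $\xi_i\in W^{1,1}(0,T;X)$ be the solution of the sweeping process with inputs $(u_i,w_i)$ and initial condition $x_i^0$, and put $x_i=u_i-\xi_i$. Then for a.e. $t\in(0,T)$, $$\begin{aligned}|\dot\xi_1(t)-\dot\xi_2(t)|&+\frac1c\frac{\mathrm{d}}{\mathrm{d}t}\big|G(x_1(t),w_1(t))-G(x_2(t),w_2(t))\big|\le\frac1c\big(K_0|\dot u_1(t)-\dot u_2(t)|+K_1|\dot w_1(t)-\dot w_2(t)|_W\big)\\&+\frac1c\Big(2C_0|\dot u_1(t)|+\Big(C_1+\frac{C_0K_1}{c}\Big)|\dot w_1(t)|_W\Big)\big(|w_1(t)-w_2(t)|_W+|x_1(t)-x_2(t)|\big).\end{aligned}$$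
   Context: $T>0$. $X$ is a real Hilbert space with inner product $\langle\cdot,\cdot\rangle$ and norm $|x|=\sqrt{\langle x,x\rangle}$; $W$ is a real Banach space with norm $|\cdot|_W$, dual $W'$ (norm $|\cdot|_{W'}$) and duality pairing written $\langle v,f\rangle_W$ for $v\in W$, $f\in W'$. $G:X\times W\to[0,\infty)$ is locally Lipschitz continuous and $Z(w):=\{x\in X: G(x,w)\le 1\}$; $\partial Z(w)$ is its boundary and $\mathrm{dist}(x,S)=\inf_{s\in S}|x-s|$. Partial gradients: $\nabla_xG(x,w)\in X$ with $\langle\nabla_xG(x,w),y\rangle=\lim_{t\to0}\frac1t(G(x+ty,w)-G(x,w))$ for all $y\in X$; $\nabla_wG(x,w)\in W'$ with $\langle v,\nabla_wG(x,w)\rangle_W=\lim_{t\to0}\frac1t(G(x,w+tv)-G(x,w))$ for all $v\in W$. Hypothesis (H): $\nabla_xG(x,w)$ exists for all $x\in X$, $w\in W$, and there are positive constants $\lambda,c,L$ and functions $\mu_1:W\times[0,\infty)\to[0,\infty)$, $\mu_2:[0,\infty)\to[0,\infty)$ with $\mu_1(w,0)=\mu_2(0)=0$, $\lim_{s\to\infty}\mu_1(w,s)=\lim_{s\to\infty}\mu_2(s)=\infty$ for every $w$, such that: (i) $G(x,w)=1\Rightarrow|\nabla_xG(x,w)|\ge c$; (ii) $|\nabla_xG(x,w)-\nabla_xG(y,w)|\le\mu_1(w,|x-y|)$ for $x,y\in Z(w)$; (iii) $\langle\nabla_xG(x,w)-\nabla_xG(z,w),x-z\rangle\ge-\lambda|x-z|^2$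 for $x\in\partial Z(w)$, $z\in Z(w)$; (iv) $|G(x,w)-G(x,w')|\le L|w-w'|_W$; (v) for $\rho>0$: $\mathrm{dist}(x,Z(w))\ge\rho\Rightarrow G(x,w)-1\ge\mu_2(\rho)$ (all for all $x,y,z\in X$, $w,w'\in W$ as indicated). Set $r:=c/\lambda$. Hypothesis (L): $\nabla_xG(x,w)$ and $\nabla_wG(x,w)$ exist for all $(x,w)\in X\times W$, and there are positive constants $K_0,K_1,C_0,C_1$ with $|\nabla_xG(x,w)|\le K_0$, $|\nabla_wG(x,w)|_{W'}\le K_1$, $|\nabla_xG(x,w)-\nabla_xG(x',w')|\le C_0(|x-x'|+|w-w'|_W)$ and $|\nabla_wG(x,w)-\nabla_wG(x',w')|_{W'}\le C_1(|x-x'|+|w-w'|_W)$ for all $(x,w),(x',w')\in X\times W$. Sweeping process: given $u\in W^{1,1}(0,T;X)$, $w\in W^{1,1}(0,T;W)$, $x_0\in Z(w(0))$, a function $\xi\in W^{1,1}(0,T;X)$ is a solution with inputs $(u,w)$ and initial condition $x_0$ if, with $x:=u-\xi$: $x(t)\in Z(w(t))$ for all $t\in[0,T]$; $\langle x(t)-z,\dot\xi(t)\rangle+\frac{|\dot\xi(t)|}{2r}|x(t)-z|^2\ge0$ for all $z\in Z(w(t))$, a.e. $t\in(0,T)$; $x(0)=x_0$. *)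

(* Defs.v *)
From HB Require Import structures.
From mathcomp Require Import all_boot all_order all_algebra.
From mathcomp Require Import all_classical all_reals all_analysis.
Set Implicit Arguments. Unset Strict Implicit. Unset Printing Implicit Defensive.
Import Order.TTheory GRing.Theory Num.Theory.
Import numFieldNormedType.Exports.
Local Open Scope classical_set_scope.
Local Open Scope ring_scope.

Section Defs.
Variable R : realType.

Definition inner_product (X : normedModType R) (ip : X -> X -> R) : Prop :=
  [/\ forall x y, ip x y = ip y x,
      forall (a : R) x y z, ip (a *: x + y) z = a * ip x z + ip y z &
      forall x, `|x| ^+ 2 = ip x x].

Definition dual_elem (W : normedModType R) (f : W -> R) : Prop :=
  (forall (a : R) v v', f (a *: v + v') = a * f v + f v') /\
  exists K : R, forall v, `|f v| <= K * `|v|.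

Definition dual_norm_le (W : normedModType R) (f : W -> R) (K : R) : Prop :=
  forall v, `|f v| <= K * `|v|.

Definition locally_lipschitz2 (X W : normedModType R) (G : X -> W -> R) : Prop :=
  forall x w, exists2 r : R, 0 < r & exists K : R,
    forall x1 w1 x2 w2, `|x1 - x| < r -> `|w1 - w| < r ->
      `|x2 - x| < r -> `|w2 - w| < r ->
      `|G x1 w1 - G x2 w2| <= K * (`|x1 - x2| + `|w1 - w2|).

(* nabla_x G : partial Gateaux gradient, represented via Riesz in X *)
Definition is_grad_x (X W : normedModType R) (ip : X -> X -> R)
    (G : X -> W -> R) (gx : X -> W -> X) : Prop :=
  forall x w y,
    (fun t : R => t^-1 * (G (x + t *: y) w - G x w)) @ 0^' --> ip (gx x w) y.

(* nabla_w G : partial Gateaux gradient in W'; gw x w v = <v, nabla_w G(x,w)> *)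
Definition is_grad_w (X W : normedModType R)
    (G : X -> W -> R) (gw : X -> W -> W -> R) : Prop :=
  forall x w, dual_elem (gw x w) /\
    forall v, (fun t : R => t^-1 * (G x (w + t *: v) - G x w)) @ 0^' --> gw x w v.

Definition Zset (X W : Type) (G : X -> W -> R) (w : W) : set X :=
  [set x | G x w <= 1].

Definition bdry (T : topologicalType) (A : set T) : set T :=
  closure A `\` interior A.

(* dist(x, S) = inf_{s in S} |x - s|, in the extended reals (inf of empty = +oo) *)
Definition dist_set (X : normedModType R) (x : X) (S : set X) : \bar R :=
  ereal_inf [set (`|x - s|)%:E | s in S].

Definition abs_cont_on (V : normedModType R) (T : R) (f : R -> V) : Prop :=
  forall e : R, 0 < e -> exists2 d : R, 0 < d & forall (n : nat) (a b : nat -> R),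
    (forall k, (k < n)%N -> 0 <= a k /\ a k <= b k /\ b k <= T) ->
    (forall k, (k.+1 < n)%N -> b k <= a k.+1) ->
    \sum_(k < n) (b k - a k) < d ->
    \sum_(k < n) `|f (b k) - f (a k)| < e.

Definition W11 (V : normedModType R) (T : R) (f : R -> V) : Prop :=
  abs_cont_on T f /\
  {ae (@lebesgue_measure R), forall t, t \in `]0, T[ -> derivable f t 1}.

Definition sweeping_solution (X W : normedModType R) (ip : X -> X -> R)
    (G : X -> W -> R) (r T : R) (u : R -> X) (w : R -> W) (x0 : X)
    (xi : R -> X) : Prop :=
  [/\ W11 T xi,
      (forall t, t \in `[0, T] -> Zset G (w t) (u t - xi t)),
      {ae (@lebesgue_measure R), forall t, t \in `]0, T[ ->
         forall z, Zset G (w t) z ->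
         0 <= ip (u t - xi t - z) (derive1 xi t)
              + `|derive1 xi t| / (2 * r) * `|u t - xi t - z| ^+ 2} &
      u 0 - xi 0 = x0].

End Defs.

(* Main.v *)
(** Along the curves [G] is differentiable by the Lipschitz bounds on its partial
    gradients.  Where [G (x_i, w_i) < 1] the velocity [xi_i'] vanishes.  Where
    [G (x_i, w_i) = 1] it is a nonnegative multiple of [a_i = nabla_x G (x_i, w_i)],
    and since [G (x_i, w_i)] is then maximal in time,
    [|a_i| |xi_i'| = <a_i, u_i'> + <w_i', nabla_w G (x_i, w_i)>].  If at most one of
    the two constraints is active, the sign of [G (x_1, w_1) - G (x_2, w_2)] makes the
    velocity and the derivative of the absolute value combine into a difference of two
    such right-hand sides; if both are active, the derivative vanishes and the
    velocities are compared through the inversion [a |-> a / |a|^2].  The absolute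
    value fails to be differentiable only at simple zeros, of which there are
    countably many. *)
Require Import Defs.
From HB Require Import structures.
From mathcomp Require Import all_boot all_order all_algebra.
From mathcomp Require Import all_classical all_reals all_analysis.
From mathcomp Require Import ring lra.
Import Order.TTheory GRing.Theory Num.Theory.
Import numFieldNormedType.Exports.
Local Open Scope classical_set_scope.
Local Open Scope ring_scope.

(** * Derivatives of functions of one real variable *)

Lemma is_derive1P {R : realType} {V : normedModType R} (f : R -> V) (t : R) (l : V) :
  is_derive t 1 f l <-> h^-1 *: (f (h + t) - f t) @[h --> 0^'] --> l.
Proof.
have E : (fun h : R => h^-1 *: ((f \o shift t) (h *: 1) - f t)) =
         (fun h => h^-1 *: (f (h + t) - f t)).
  by apply/funext => h; rewrite /= [h *: _]mulr1.
split=> [[df <-]|fl].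
  by rewrite -E; exact: df.
have fl' : h^-1 *: ((f \o shift t) (h *: 1) - f t) @[h --> 0^'] --> l by rewrite E.
by apply: DeriveDef; [exact: (cvgP _ fl')|exact: (cvg_lim _ fl')].
Qed.

Lemma near_shift0 {R : realType} (t : R) (P : R -> Prop) :
  (\forall s \near t, P s) -> \forall h \near 0, P (h + t).
Proof.
move=> Pt.
have : h + t @[h --> (0 : R)] --> t.
  by rewrite -[X in _ --> X]add0r; apply: cvgD; [exact: cvg_id|exact: cvg_cst].
exact.
Qed.

(** Near [t] the right difference quotients are nonpositive and the left ones nonnegative. *)
Lemma is_derive_local_max {R : realType} (f : R -> R) (t l : R) :
  is_derive t 1 f l -> (\forall s \near t, f s <= f t) -> l = 0.
Proof.
move=> /is_derive1P fl /near_shift0 mx; apply/le_anti/andP; split.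
- apply: (cvgr_to_le (cvg_dnbhs_at_right fl)).
  near=> h; rewrite [_ *: _]mulrC pmulr_lle0 ?invr_gt0 // subr_le0.
  by near: h; exact: cvg_within mx.
- apply: (cvgr_to_ge (cvg_dnbhs_at_left fl)).
  near=> h; rewrite [_ *: _]mulrC nmulr_lge0 ?invr_lt0 // subr_le0.
  by near: h; exact: cvg_within mx.
Unshelve. all: by end_near. Qed.

Lemma is_derive1_continuous {R : realType} {V : normedModType R} (f : R -> V) (t : R) (l : V) :
  is_derive t 1 f l -> {for t, continuous f}.
Proof. by case=> /derivable1_diffP/differentiable_continuous. Qed.

(** Where [f t] is nonzero, [f] keeps its sign near [t]. Where [f t = 0], the difference quotients
    of [|f|] and [f] have the same absolute value, so both tend to [0]; since [sg 0 = 0], one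
    formula covers all cases. *)
Lemma is_derive_abs {R : realType} (f : R -> R) (t l : R) :
  is_derive t 1 f l -> (f t = 0 -> l = 0) ->
  is_derive t 1 (fun s => `|f s|) (Num.sg (f t) * l).
Proof.
move=> fl l0; have fc := is_derive1_continuous _ _ _ fl.
have [ft|ft|ft] := ltrgt0P (f t).
- rewrite gtr0_sg // mul1r; apply: near_eq_is_derive fl.
  by near=> s; rewrite gtr0_norm //; near: s; exact: cvgr_gt fc _ ft.
- rewrite ltr0_sg // mulN1r; have flN := is_deriveN fl.
  apply: near_eq_is_derive flN.
  by near=> s; rewrite ltr0_norm //; near: s; exact: cvgr_lt fc _ ft.
- rewrite ft sgr0 mul0r; move/is_derive1P: fl; rewrite (l0 ft) => fl.
  apply/is_derive1P/cvgr0Pnorm_lt => e e0.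
  move/cvgr0Pnorm_lt: fl => /(_ e e0); apply: filterS => h.
  by rewrite ft normr0 !subr0 !normrZ normr_id.
Unshelve. all: by end_near. Qed.

(** * Countability of simple zeros *)

(** Each cell [[k e, (k + 1) e)] with [k] an integer holds at most one point of [A], so the index of
    the cell enumerates [A]. *)
Lemma countable_uniformly_discrete {R : realType} (A : set R) (e : R) :
  0 < e -> (forall s t, A s -> A t -> `|s - t| < e -> s = t) -> countable A.
Proof.
move=> e0 sep; apply/countable_injP.
exists (fun t => choice.pickle (Num.floor (t / e))) => s t /set_mem As /set_mem At.
move=> /(pcan_inj choice.pickleK) E; apply: sep => //.
have /andP[s1 s2] := floor_itv (s / e); have /andP[t1 t2] := floor_itv (t / e).
rewrite E in s1 s2; rewrite intrD in s2 t2.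
have : `|s / e - t / e| < 1 by rewrite ltr_norml; apply/andP; split; lra.
by rewrite -mulrBl normrM normfV (gtr0_norm e0) ltr_pdivrMr // mul1r.
Qed.

(** A zero with nonzero derivative is isolated. Sorting such zeros by an isolating radius
    [1 / (n + 1)] gives countably many uniformly discrete sets. *)
Lemma countable_simple_zeros {R : realType} (f : R -> R) :
  countable [set t | f t = 0 /\ exists2 l, l != 0 & is_derive t 1 f l].
Proof.
pose A n := [set t : R | f t = 0 /\
  forall h, h != 0 -> `|h| < n.+1%:R^-1 -> f (h + t) != 0].
apply: (@sub_countable _ _ _ (\bigcup_n A n)).
  apply: subset_card_le => t [ft [l l0 /is_derive1P fl]].
  have : \forall h \near 0^', f (h + t) != 0.
    have : \forall h \near 0^', h^-1 *: (f (h + t) - f t) != 0.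
      exact: cvgr_neq0 fl l0.
    apply: filterS => h; apply: contra_neq => ->.
    by rewrite ft subr0 scaler0.
  move=> /nbhs_ballP[e /= e0 fe].
  have [n ne] : exists n, n.+1%:R^-1 < e.
    exists (Num.truncn e^-1); rewrite invf_plt ?posrE // ?truncnS_gt //.
  exists n => //; split=> // h h0 hn; apply: fe => //.
  by rewrite -ball_normE /= sub0r normrN (lt_trans hn).
apply: bigcup_countable => // n _.
apply: (@countable_uniformly_discrete _ _ n.+1%:R^-1); first by rewrite invr_gt0.
move=> s t [fs _] [_ At] st; apply/eqP; rewrite -subr_eq0; apply/negP => /negP st0.
by have := At _ st0 st; rewrite subrK fs eqxx.
Qed.

(** * Bounded linear functionals and inner products *)

Lemma cvg_dist_le {R : realType} {V : normedModType R} {S : Type} (F : set_system S)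
    {FF : Filter F} (f : S -> V) (g : S -> R) (l : V) :
  (\forall s \near F, `|f s - l| <= g s) -> g @ F --> 0 -> f @ F --> l.
Proof.
move=> fg g0; apply/cvgrPdist_lt => e e0.
near=> s; rewrite distrC; apply: (@le_lt_trans _ _ (g s)).
  by near: s.
rewrite (le_lt_trans (ler_norm _)) //; near: s.
by move/cvgr0Pnorm_lt: g0; apply.
Unshelve. all: by end_near. Qed.

Section dual_elem.
Context {R : realType} {V : normedModType R} {f : V -> R} (df : dual_elem f).

Lemma dual_elemD x y : f (x + y) = f x + f y.
Proof. by have [fL _] := df; rewrite -[x in LHS]scale1r fL mul1r. Qed.

Lemma dual_elem0 : f 0 = 0.
Proof. by have := dual_elemD 0 0; rewrite addr0; lra. Qed.

Lemma dual_elemZ a x : f (a *: x) = a * f x.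
Proof. by have [fL _] := df; rewrite -[a *: x]addr0 fL dual_elem0 addr0. Qed.

Lemma dual_elemN x : f (- x) = - f x.
Proof. by rewrite -scaleN1r dual_elemZ mulN1r. Qed.

Lemma dual_elemB x y : f (x - y) = f x - f y.
Proof. by rewrite dual_elemD dual_elemN. Qed.

Lemma cvg_dual_elem {S : Type} (F : set_system S) {FF : Filter F} (g : S -> V) (l : V) :
  g @ F --> l -> f (g s) @[s --> F] --> f l.
Proof.
move=> gl; have [_ [K fK]] := df.
apply: (@cvg_dist_le _ _ _ _ _ _ (fun s => K * `|g s - l|)).
  by apply: nearW => s; rewrite -dual_elemB; exact: fK.
rewrite -[X in _ --> X](mulr0 K); apply: cvgM; first exact: cvg_cst.
rewrite -(@normr0 _ V) -(subrr l); apply: cvg_norm; apply: cvgB => //; exact: cvg_cst.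
Qed.

End dual_elem.

Section inner_product.
Context {R : realType} {X : normedModType R} {ip : X -> X -> R}.
Context (Hip : inner_product ip).

Lemma ipC x y : ip x y = ip y x. Proof. by case: Hip. Qed.

Lemma ipxx x : ip x x = `|x| ^+ 2. Proof. by case: Hip. Qed.

Lemma ip_lin (a : R) x y z : ip z (a *: x + y) = a * ip z x + ip z y.
Proof. by case: Hip => C L _; rewrite C L !(C z). Qed.

Lemma ipDr z x y : ip z (x + y) = ip z x + ip z y.
Proof. by rewrite -[x in LHS]scale1r ip_lin mul1r. Qed.

Lemma ip0r z : ip z 0 = 0.
Proof. by have := ipDr z 0 0; rewrite addr0; lra. Qed.

Lemma ipZr z (a : R) x : ip z (a *: x) = a * ip z x.
Proof. by rewrite -[a *: x]addr0 ip_lin ip0r addr0. Qed.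

Lemma ipNr z x : ip z (- x) = - ip z x.
Proof. by rewrite -scaleN1r ipZr mulN1r. Qed.

Lemma ipBr z x y : ip z (x - y) = ip z x - ip z y.
Proof. by rewrite ipDr ipNr. Qed.

Lemma ipDl z x y : ip (x + y) z = ip x z + ip y z.
Proof. by rewrite ipC ipDr !(ipC z). Qed.

Lemma ipZl z (a : R) x : ip (a *: x) z = a * ip x z.
Proof. by rewrite ipC ipZr (ipC z). Qed.

Lemma ipNl z x : ip (- x) z = - ip x z.
Proof. by rewrite ipC ipNr (ipC z). Qed.

Lemma ipBl z x y : ip (x - y) z = ip x z - ip y z.
Proof. by rewrite ipC ipBr !(ipC z). Qed.

Definition ipE := (ipDr, ipNr, ipZr, ipDl, ipNl, ipZl).

Lemma ip_cauchy_schwarz x y : `|ip x y| <= `|x| * `|y|.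
Proof.
have [->|y0] := eqVneq y 0; first by rewrite ip0r !normr0 mulr0.
have ny : 0 < `|y| ^+ 2 by rewrite exprn_gt0 // normr_gt0.
rewrite -ler_sqr ?nnegrE ?mulr_ge0 // real_normK ?num_real // exprMn.
rewrite -subr_ge0 -(pmulr_rge0 _ ny).
(* The squared norm of this vector expands to [|y|^2 (|x|^2 |y|^2 - <x,y>^2)]. *)
have := sqr_ge0 `|(`|y| ^+ 2) *: x - ip x y *: y|.
by rewrite -(ipxx (_ - _)) !ipE !ipxx (ipC y x); congr (_ <= _); ring.
Qed.

Lemma dual_elem_ip x : dual_elem (ip x).
Proof.
split=> [a v v'|]; first exact: ip_lin.
by exists `|x| => v; exact: ip_cauchy_schwarz.
Qed.

End inner_product.

(** * Mean values along segments and the chain rule for [G] *)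

Section gateaux.
Context {R : realType} {V : normedModType R} {F : V -> R} {dF : V -> V -> R}.
Context (HF : forall x v, t^-1 * (F (x + t *: v) - F x) @[t --> 0^'] --> dF x v).

Lemma is_derive_line x v (s : R) :
  is_derive s 1 (fun s => F (x + s *: v)) (dF (x + s *: v) v).
Proof.
apply/is_derive1P; have := HF (x + s *: v) v.
suff -> : (fun h => h^-1 *: (F (x + (h + s) *: v) - F (x + s *: v))) =
  (fun t => t^-1 * (F (x + s *: v + t *: v) - F (x + s *: v))) by [].
by apply/funext => h; rewrite scalerDl addrAC addrA.
Qed.

Lemma gateaux_mvt x v :
  exists2 s : R, 0 <= s <= 1 & F (x + v) - F x = dF (x + s *: v) v.
Proof.
have := @MVT_segment R (fun s => F (x + s *: v)) (fun s => dF (x + s *: v) v) 0 1 ler01.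
case.
- by move=> s _; exact: is_derive_line.
- by apply: derivable_within_continuous => s _; case: (is_derive_line x v s).
- move=> s; rewrite in_itv /= => s01; rewrite scale1r scale0r addr0 subr0 mulr1.
  by exists s.
Qed.

End gateaux.

Section chain_rule.
Context {R : realType} {X W : normedModType R} {ip : X -> X -> R} (Hip : inner_product ip).
Context {G : X -> W -> R} {gx : X -> W -> X} {gw : X -> W -> W -> R} {C0 C1 : R}.
Context (Hgx : is_grad_x ip G gx) (Hgw : is_grad_w G gw).
Context (C0_ge0 : 0 <= C0) (C1_ge0 : 0 <= C1).
Context (HC0 : forall x w x' w', `|gx x w - gx x' w'| <= C0 * (`|x - x'| + `|w - w'|)).
Context (HC1 : forall x w x' w',
  dual_norm_le (fun v => gw x w v - gw x' w' v) (C1 * (`|x - x'| + `|w - w'|))).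

(** The increment is split into a move in [x] at fixed [w + q] and a move in [w] at fixed [x]. The
    mean value theorem turns each into a gradient at an intermediate point, and the Lipschitz bounds
    compare it with the gradient at [(x, w)]. Partial Gateaux gradients thus yield joint
    differentiability with a quadratic remainder. *)
Lemma grad_taylor x w p q :
  `|G (x + p) (w + q) - G x w - (ip (gx x w) p + gw x w q)|
  <= (C0 + C1) * (`|p| + `|q|) ^+ 2.
Proof.
have [s /andP[s0 s1] Es] := gateaux_mvt (fun x v => Hgx x (w + q) v) x p.
have [r /andP[r0 r1] Er] := gateaux_mvt (fun w v => proj2 (Hgw x w) v) w q.
have shrink (V : normedModType R) (y v : V) (a : R) : 0 <= a -> a <= 1 ->
    `|y + a *: v - y| <= `|v|.
  move=> a0 a1; rewrite addrAC subrr add0r normrZ (ger0_norm a0).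
  by rewrite ler_piMl.
have -> : G (x + p) (w + q) - G x w - (ip (gx x w) p + gw x w q) =
  ip (gx (x + s *: p) (w + q) - gx x w) p + (gw x (w + r *: q) q - gw x w q).
  by rewrite (ipBl Hip) -Es -Er; ring.
have pq0 : 0 <= `|p| + `|q| by rewrite addr_ge0.
apply: (le_trans (ler_normD _ _)).
rewrite mulrDl; apply: (@le_trans _ _ (C0 * (`|p| + `|q|) * `|p| + C1 * (`|p| + `|q|) * `|q|)).
  apply: lerD.
    apply: (le_trans (ip_cauchy_schwarz Hip _ _)); apply: ler_wpM2r => //.
    apply: (le_trans (HC0 _ _ _ _)); apply: ler_wpM2l => //; apply: lerD; first exact: shrink.
    by rewrite addrAC subrr add0r.
  apply: (le_trans (HC1 _ _ _ _ _)); apply: ler_wpM2r => //.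
  apply: ler_wpM2l => //; rewrite subrr normr0 add0r.
  by apply: (le_trans (shrink _ _ _ _ r0 r1)); rewrite lerDr.
rewrite !expr2 !mulrA; apply: lerD; apply: ler_wpM2l; rewrite ?mulr_ge0 //.
- by rewrite lerDl.
- by rewrite lerDr.
Qed.

Lemma is_derive_grad {x : R -> X} {w : R -> W} {t : R} {dx : X} {dw : W} :
  is_derive t 1 x dx -> is_derive t 1 w dw ->
  is_derive t 1 (fun s => G (x s) (w s))
    (ip (gx (x t) (w t)) dx + gw (x t) (w t) dw).
Proof.
move=> /is_derive1P xd /is_derive1P wd; apply/is_derive1P.
pose p h := x (h + t) - x t; pose q h := w (h + t) - w t.
pose l h := ip (gx (x t) (w t)) (h^-1 *: p h) + gw (x t) (w t) (h^-1 *: q h).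
have Dx := dual_elem_ip Hip (gx (x t) (w t)); have [Dw _] := Hgw (x t) (w t).
have lC : l h @[h --> 0^'] --> ip (gx (x t) (w t)) dx + gw (x t) (w t) dw.
  by apply: cvgD; [exact: (cvg_dual_elem Dx _ _ _ xd)|exact: (cvg_dual_elem Dw _ _ _ wd)].
pose rest h := h^-1 *: (G (x (h + t)) (w (h + t)) - G (x t) (w t)) - l h.
have restC : rest h @[h --> 0^'] --> 0.
  (* The Taylor remainder divided by [|h|], written as [|h|] times the square of difference
     quotients, which converge. *)
  pose g h := (C0 + C1) * (`|h| * (`|h^-1 *: p h| + `|h^-1 *: q h|) ^+ 2).
  apply: (@cvg_dist_le _ _ _ _ _ _ g).
    near=> h; have h0 : h != 0 by near: h; exact: nbhs_dnbhs_neq.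
    rewrite subr0 /rest /l (dual_elemZ Dx) (dual_elemZ Dw) -mulrDr.
    rewrite [_ *: _]/GRing.scale /= -mulrBr normrM normfV.
    have := grad_taylor (x t) (w t) (p h) (q h).
    rewrite /p /q !(addrC (_ t) (_ - _ t)) !subrK => gt.
    have h1 : 0 < `|h| by rewrite normr_gt0.
    rewrite /g !normrZ !normfV -mulrDr exprMn.
    rewrite ler_pdivrMl //; apply: le_trans gt _; rewrite /p /q.
    rewrite le_eqVlt; apply/orP; left; apply/eqP; field.
    by rewrite gt_eqF.
  rewrite -[X in _ --> X](mulr0 (C0 + C1)); apply: cvgM; first exact: cvg_cst.
  rewrite -[X in _ --> X](mul0r ((`|dx| + `|dw|) ^+ 2)); apply: cvgM.
    rewrite -[X in _ --> X](@normr0 _ R); apply: cvg_norm; exact: cvg_within.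
  apply: cvgM; apply: cvgD; exact: cvg_norm.
rewrite -[X in _ --> X]addr0.
suff -> : (fun h => h^-1 *: (G (x (h + t)) (w (h + t)) - G (x t) (w t))) =
  (fun h => l h + rest h) by exact: cvgD.
by apply/funext => h; rewrite /rest [RHS]addrC subrK.
Unshelve. all: by end_near. Qed.

End chain_rule.

(** * Normal vectors of a sublevel set *)

Section normal_cone.
Context {R : realType} {X : normedModType R} {ip : X -> X -> R} (Hip : inner_product ip).

(** Testing with [z = x + s y] and dividing by [s] leaves a quadratic term of order [s], which
    disappears as [s] tends to [0] from the right. *)
Lemma normal_direction_le0 (Z : set X) (k : R) (x v y : X) :
  (forall z, Z z -> 0 <= ip (x - z) v + k * `|x - z| ^+ 2) ->
  (\forall s \near 0^'+, Z (x + s *: y)) -> ip y v <= 0.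
Proof.
move=> Zv Zy.
have lim0 : s * (k * `|y| ^+ 2) @[s --> 0^'+] --> 0.
  rewrite -[X in _ --> X](mul0r (k * `|y| ^+ 2)); apply: cvgM; last exact: cvg_cst.
  by exact: cvg_within.
apply: (cvgr_to_ge lim0); near=> s.
have s0 : 0 < s by [].
have : Z (x + s *: y) by near: s.
move=> /Zv; rewrite opprD addrA subrr add0r normrN normrZ (gtr0_norm s0) exprMn.
rewrite -scaleN1r !(ipZl Hip) => h; rewrite -(ler_pM2l s0).
by lra.
Unshelve. all: by end_near. Qed.

Context {F : X -> R} {a : X -> X}.
Context (HF : forall x v, t^-1 * (F (x + t *: v) - F x) @[t --> 0^'] --> ip (a x) v).

(** Continuity of [F] along the single line [x + s v] makes [v] itself an admissible direction, so
    [<v,v> <= 0]. *)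
Lemma sublevel_interior_normal (k : R) (x v : X) : F x < 1 ->
  (forall z, F z <= 1 -> 0 <= ip (x - z) v + k * `|x - z| ^+ 2) -> v = 0.
Proof.
move=> Fx Zv; have : ip v v <= 0.
  apply: (normal_direction_le0 [set z | F z <= 1] k x _ _ Zv).
  have := is_derive1_continuous _ _ _ (is_derive_line HF x v 0).
  move=> /cvgr_lt /= /(_ 1); rewrite scale0r addr0 => /(_ Fx) H.
  by apply: cvg_within; apply: filterS H => s /ltW.
by rewrite (ipxx Hip) expr2 => v0; apply/normr0_eq0/eqP; rewrite -sqrf_eq0 expr2 eq_le v0 -expr2 sqr_ge0.
Qed.

(** Every [y] with [<a x, y> < 0] points into the sublevel set, hence [<y,v> <= 0]. A vector [v]
    with this property on an open half-space must lie on the ray of [a x]: its component [p]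
    orthogonal to [a x] is shown to vanish. *)
Lemma sublevel_boundary_normal (k : R) (x v : X) : F x <= 1 -> a x != 0 ->
  (forall z, F z <= 1 -> 0 <= ip (x - z) v + k * `|x - z| ^+ 2) ->
  exists2 m : R, 0 <= m & v = m *: a x.
Proof.
move=> Fx a0 Zv.
have desc y : ip (a x) y < 0 -> ip y v <= 0.
  move=> ay; apply: (normal_direction_le0 [set z | F z <= 1] k x _ _ Zv).
  near=> s => /=.
  have s0 : 0 < s by [].
  have : s^-1 * (F (x + s *: y) - F x) < 0.
    near: s; apply: cvgr_lt ay; exact: cvg_dnbhs_at_right (HF x y).
  rewrite pmulr_rlt0 ?invr_gt0 // subr_lt0 => /ltW /le_trans; exact.
have na : 0 < `|a x| ^+ 2 by rewrite exprn_gt0 // normr_gt0.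
have av : 0 <= ip (a x) v.
  have := desc (- a x); rewrite (ipNr Hip) (ipxx Hip) oppr_lt0 => /(_ na).
  by rewrite (ipC Hip) (ipNr Hip) (ipC Hip) oppr_le0.
exists (ip (a x) v / `|a x| ^+ 2); first by rewrite divr_ge0 // ltW.
set m := _ / _; pose p := v - m *: a x.
have ap : ip (a x) p = 0.
  rewrite (ipBr Hip) (ipZr Hip) (ipxx Hip) /m divfK ?subrr //.
  by rewrite gt_eqF.
have pv : ip p v = `|p| ^+ 2.
  by rewrite -(ipxx Hip) {3}/p (ipBr Hip) (ipZr Hip) (ipC Hip p (a x)) ap mulr0 subr0.
(* The direction [p] is only tangent; subtracting [e *: a x] makes it strictly descending. *)
have small e : 0 < e -> `|p| ^+ 2 <= e * ip (a x) v.
  move=> e0; have := desc (p - e *: a x).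
  rewrite (ipBr Hip) (ipZr Hip) ap (ipxx Hip) sub0r oppr_lt0 mulr_gt0 // => /(_ isT).
  by rewrite (ipBl Hip) (ipZl Hip) pv subr_le0.
have p0 : `|p| ^+ 2 <= 0.
  apply/ler_addgt0Pl => e e0; rewrite addr0.
  (* The added [1] keeps the divisor positive when [<a x, v> = 0]. *)
  have q0 : 0 < ip (a x) v + 1 by rewrite ltr_wpDl.
  apply: (le_trans (small (e / (ip (a x) v + 1)) _)); first by rewrite divr_gt0.
  by rewrite mulrAC ler_pdivrMr // ler_pM2l // lerDl.
apply/eqP; rewrite -subr_eq0 -/p -normr_eq0 -sqrf_eq0 eq_le p0.
exact: sqr_ge0.
Unshelve. all: by end_near. Qed.

End normal_cone.

(** * Inversion and comparison of two normal vectors *)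

Section projections.
Context {R : realType} {X : normedModType R} {ip : X -> X -> R} (Hip : inner_product ip).

Lemma normr_inversion (a : X) : a != 0 -> `|(`|a| ^- 2) *: a| = `|a|^-1.
Proof.
move=> a0; rewrite normrZ ger0_norm ?invr_ge0 ?exprn_ge0 //.
by field; rewrite normr_eq0.
Qed.

(** Both sides square to [|a|^-2 - 2 <a,b> |a|^-2 |b|^-2 + |b|^-2]. *)
Lemma dist_inversion (a b : X) : a != 0 -> b != 0 ->
  `|(`|a| ^- 2) *: a - `|b| ^- 2 *: b| = `|a - b| / (`|a| * `|b|).
Proof.
move=> a0 b0; apply/eqP; rewrite -(@eqrXn2 _ 2) ?divr_ge0 ?mulr_ge0 //.
apply/eqP; rewrite exprMn exprVn -(ipxx Hip (_ *: _ - _)) -(ipxx Hip (a - b)) !(ipE Hip) !(ipxx Hip) (ipC Hip b a).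
by field; rewrite !normr_eq0 a0 b0.
Qed.

(* Both vectors have the form [<a,u> b + om b] with [b] the inversion [a / |a|^2],
   which is Lipschitz with constant [1 / (|a1| |a2|)]. *)
Lemma dist_normal_components (a1 a2 u1 u2 : X) (c K0 k1 k2 om1 om2 : R) :
  0 < c -> c <= `|a1| -> c <= `|a2| -> `|a2| <= K0 ->
  k1 * `|a1| ^+ 2 = ip a1 u1 + om1 -> k2 * `|a2| ^+ 2 = ip a2 u2 + om2 ->
  `|k1 *: a1 - k2 *: a2| <= c^-1 * (K0 * `|u1 - u2| + `|om1 - om2|) +
     c^-1 * (`|a1 - a2| * (2 * `|u1| + `|om1| / c)).
Proof.
move=> c0 ca1 ca2 aK E1 E2.
have n1 : 0 < `|a1| := lt_le_trans c0 ca1; have n2 : 0 < `|a2| := lt_le_trans c0 ca2.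
have a10 : a1 != 0 by rewrite -normr_gt0.
have a20 : a2 != 0 by rewrite -normr_gt0.
pose b1 := `|a1| ^- 2 *: a1; pose b2 := `|a2| ^- 2 *: a2.
have -> : k1 *: a1 = (ip a1 u1 + om1) *: b1.
  by rewrite -E1 scalerA mulfK // sqrf_eq0 gt_eqF.
have -> : k2 *: a2 = (ip a2 u2 + om2) *: b2.
  by rewrite -E2 scalerA mulfK // sqrf_eq0 gt_eqF.
(* The telescoping puts index 1 on the factors multiplying [b1 - b2] and [a1 - a2], so only [|u1|]
   and [|om1|] accompany [|a1 - a2|] in the bound. *)
have -> : (ip a1 u1 + om1) *: b1 - (ip a2 u2 + om2) *: b2 =
    (ip a1 u1 + om1) *: (b1 - b2) +
    (ip (a1 - a2) u1 + ip a2 (u1 - u2) + (om1 - om2)) *: b2.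
  rewrite (ipBl Hip) (ipBr Hip) scalerBr -addrA -scaleNr -scaleNr -scalerDl.
  by congr (_ + _ *: _); ring.
have nb2 : `|b2| = `|a2|^-1 by exact: normr_inversion.
have nb : `|b1 - b2| = `|a1 - a2| / (`|a1| * `|a2|) by exact: dist_inversion.
have cV1 : `|a1|^-1 <= c^-1 by rewrite lef_pV2 ?posrE.
have cV2 : `|a2|^-1 <= c^-1 by rewrite lef_pV2 ?posrE.
apply: (le_trans (ler_normD _ _)); rewrite (normrZ _ (b1 - b2)) (normrZ _ b2) nb2 nb.
have i1 := ip_cauchy_schwarz Hip a1 u1.
have i2 := ip_cauchy_schwarz Hip (a1 - a2) u1.
have i3 : `|ip a2 (u1 - u2)| <= K0 * `|u1 - u2|.
  by apply: (le_trans (ip_cauchy_schwarz Hip _ _)); exact: ler_wpM2r.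
(* The factor [1 / |a1|] cancels against Cauchy-Schwarz in [<a1,u1>], so only [om1] costs an
   additional [1 / c]. The term [|a1 - a2| |u1|] arises here and again in [second], whence the
   factor 2. *)
have first : `|ip a1 u1 + om1| * (`|a1 - a2| / (`|a1| * `|a2|)) <=
    c^-1 * (`|a1 - a2| * (`|u1| + `|om1| / c)).
  apply: (@le_trans _ _ ((`|u1| + `|om1| / `|a1|) * `|a1 - a2| / `|a2|)).
    have -> : `|ip a1 u1 + om1| * (`|a1 - a2| / (`|a1| * `|a2|)) =
       (`|ip a1 u1 + om1| / `|a1|) * (`|a1 - a2| / `|a2|).
      by field; rewrite !gt_eqF.
    rewrite -[leRHS]mulrA; apply: ler_wpM2r; first by rewrite divr_ge0.
    rewrite ler_pdivrMr // mulrDl divfK ?gt_eqF // (mulrC `|u1|).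
    by apply: (le_trans (ler_normD _ _)); rewrite lerD2r.
  rewrite mulrC; apply: ler_pM; rewrite ?invr_ge0 ?mulr_ge0 ?addr_ge0 ?divr_ge0 //.
  rewrite mulrC; apply: ler_wpM2l => //; rewrite lerD2l.
  by apply: ler_wpM2l.
have second : `|ip (a1 - a2) u1 + ip a2 (u1 - u2) + (om1 - om2)| * `|a2|^-1 <=
    c^-1 * (`|a1 - a2| * `|u1| + K0 * `|u1 - u2| + `|om1 - om2|).
  rewrite mulrC; apply: ler_pM; rewrite ?invr_ge0 //.
  apply: (le_trans (ler_normD _ _)); rewrite lerD2r.
  by apply: (le_trans (ler_normD _ _)); exact: lerD.
apply: (le_trans (lerD first second)).
by rewrite le_eqVlt; apply/orP; left; apply/eqP; ring.
Qed.

End projections.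

(** * Velocity of the sweeping process *)

Section sweeping.
Context {R : realType} {X W : normedModType R} {ip : X -> X -> R} (Hip : inner_product ip).
Context {G : X -> W -> R} {gx : X -> W -> X} {gw : X -> W -> W -> R} {C0 C1 c : R}.
Context (Hgx : is_grad_x ip G gx) (Hgw : is_grad_w G gw).
Context (C0_ge0 : 0 <= C0) (C1_ge0 : 0 <= C1).
Context (HC0 : forall x w x' w', `|gx x w - gx x' w'| <= C0 * (`|x - x'| + `|w - w'|)).
Context (HC1 : forall x w x' w',
  dual_norm_le (fun v => gw x w v - gw x' w' v) (C1 * (`|x - x'| + `|w - w'|))).
Context (c_gt0 : 0 < c) (Hc : forall x w, G x w = 1 -> c <= `|gx x w|).

(* On the boundary, [s |-> G (x s) (w s)] is maximal at [t], so its derivative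
   vanishes; this determines the multiplier of the normal vector. *)
Lemma sweeping_velocity (u xi : R -> X) (w : R -> W) (t k : R) (du dxi : X) (dw : W)
    (x := u t - xi t) (a := gx x (w t)) :
  is_derive t 1 u du -> is_derive t 1 xi dxi -> is_derive t 1 w dw ->
  (\forall s \near t, G (u s - xi s) (w s) <= 1) ->
  (forall z, G z (w t) <= 1 -> 0 <= ip (x - z) dxi + k * `|x - z| ^+ 2) ->
  (G x (w t) < 1 /\ dxi = 0) \/
  [/\ G x (w t) = 1, c <= `|a|, ip a (du - dxi) + gw x (w t) dw = 0 &
    exists m, [/\ 0 <= m, dxi = m *: a & m * `|a| ^+ 2 = ip a du + gw x (w t) dw]].
Proof.
move=> Du Dxi Dw Gle Zn.
have Gt : G x (w t) <= 1 by exact: nbhs_singleton Gle.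
have grad := fun y v => Hgx y (w t) v.
have [G1|G1] : G x (w t) = 1 \/ G x (w t) < 1.
  by case: (ltgtP (G x (w t)) 1) Gt => // ? _; [right|left].
  right; have ca : c <= `|a| by exact: Hc.
  have na : 0 < `|a| by exact: lt_le_trans ca.
  have [m m0 E] := sublevel_boundary_normal Hip grad k x dxi Gt
    (etrans (esym (normr_gt0 _)) na) Zn.
  have stat : ip a (du - dxi) + gw x (w t) dw = 0.
    have Dx := is_deriveB Du Dxi.
    apply: (is_derive_local_max _ _ _ (is_derive_grad Hip Hgx Hgw C0_ge0 C1_ge0 HC0 HC1 Dx Dw)).
    by rewrite /= G1.
  split=> //; exists m; split=> //.
  by move: stat; rewrite {1}E (ipBr Hip) (ipZr Hip) (ipxx Hip) => stat; lra.
left; split=> //; exact: (sublevel_interior_normal Hip grad k x dxi G1 Zn).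
Qed.

End sweeping.

(** * Pointwise rate estimate, by cases on the active constraints *)

Section rate_estimate.
Context {R : realType} {X : normedModType R} {ip : X -> X -> R} (Hip : inner_product ip).
Context {c K0 K1 C0 C1 dl : R} (c_gt0 : 0 < c) (K1_ge0 : 0 <= K1).
Context (C0_ge0 : 0 <= C0) (dl_ge0 : 0 <= dl).

(* [g_i] stands for [G(x_i, w_i)], [a_i] for its [x]-gradient and [om_i] for its
   [w]-derivative along [w_i']; [om21] is the one of [G(x_2, .)] along [w_1'], and
   [nw1], [nw12] are the norms of [w_1'] and [w_1' - w_2']. *)
Lemma sweeping_rate_estimate (a1 a2 du1 du2 dxi1 dxi2 : X) (g1 g2 om1 om2 om21 nw1 nw12 : R) :
  0 <= nw1 ->
  `|a2| <= K0 -> `|a1 - a2| <= C0 * dl ->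
  `|om1| <= K1 * nw1 -> `|om1 - om21| <= C1 * dl * nw1 -> `|om21 - om2| <= K1 * nw12 ->
  (g1 < 1 /\ dxi1 = 0) \/ [/\ g1 = 1, c <= `|a1|, ip a1 (du1 - dxi1) + om1 = 0 &
    exists m, [/\ 0 <= m, dxi1 = m *: a1 & m * `|a1| ^+ 2 = ip a1 du1 + om1]] ->
  (g2 < 1 /\ dxi2 = 0) \/ [/\ g2 = 1, c <= `|a2|, ip a2 (du2 - dxi2) + om2 = 0 &
    exists m, [/\ 0 <= m, dxi2 = m *: a2 & m * `|a2| ^+ 2 = ip a2 du2 + om2]] ->
  `|dxi1 - dxi2| + c^-1 * (Num.sg (g1 - g2) *
     (ip a1 (du1 - dxi1) + om1 - (ip a2 (du2 - dxi2) + om2)))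
  <= c^-1 * (K0 * `|du1 - du2| + K1 * nw12) +
     c^-1 * (2 * C0 * `|du1| + (C1 + C0 * K1 / c) * nw1) * dl.
Proof.
move=> nw1_ge0 aK aC oK oC oK2 alt1 alt2.
(* [c^-1 * B] suffices unless both constraints are active. The final bound exceeds it through the
   second [C0 |u_1'|] and the term [C0 K1 / c], which come from the inversion estimate in the
   remaining case. *)
pose B := K0 * `|du1 - du2| + K1 * nw12 + (C0 * `|du1| + C1 * nw1) * dl.
have om12 : `|om1 - om2| <= K1 * nw12 + C1 * nw1 * dl.
  by rewrite -(subrKA om21) (le_trans (ler_normD _ _)) //; lra.
have AB : `|ip a1 du1 + om1 - (ip a2 du2 + om2)| <= B.
  have -> : ip a1 du1 + om1 - (ip a2 du2 + om2) =
      ip (a1 - a2) du1 + ip a2 (du1 - du2) + (om1 - om2).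
    by rewrite !(ipE Hip); ring.
  have e1 : `|ip (a1 - a2) du1| <= C0 * dl * `|du1|.
    by apply: (le_trans (ip_cauchy_schwarz Hip _ _)); exact: ler_wpM2r.
  have e2 : `|ip a2 (du1 - du2)| <= K0 * `|du1 - du2|.
    by apply: (le_trans (ip_cauchy_schwarz Hip _ _)); exact: ler_wpM2r.
  have e3 := ler_normD (ip (a1 - a2) du1 + ip a2 (du1 - du2)) (om1 - om2).
  have e4 := ler_normD (ip (a1 - a2) du1) (ip a2 (du1 - du2)).
  by rewrite /B; lra.
have cV : 0 < c^-1 by rewrite invr_gt0.
have BR : c^-1 * B <= c^-1 * (K0 * `|du1 - du2| + K1 * nw12) +
     c^-1 * (2 * C0 * `|du1| + (C1 + C0 * K1 / c) * nw1) * dl.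
  rewrite -[X in _ + X]mulrA -mulrDr ler_pM2l // /B lerD2l.
  apply: ler_wpM2r => //; apply: lerD.
    by rewrite -mulrA ler_peMl ?mulr_ge0 // ler1n.
  by apply: ler_wpM2r => //; rewrite lerDl divr_ge0 ?mulr_ge0 // ltW.
(* Here [|dxi| = m |a|], and [c m |a| <= m |a|^2]. *)
have speed a du dxi om : c <= `|a| -> (exists m, [/\ 0 <= m, dxi = m *: a &
    m * `|a| ^+ 2 = ip a du + om]) -> `|dxi| <= c^-1 * (ip a du + om).
  move=> ca [m [m0 -> <-]]; rewrite normrZ (ger0_norm m0) ler_pdivlMl //.
  by rewrite expr2 mulrCA ler_wpM2l // ler_wpM2r.
case: alt1 => [[g1lt ->]|[g1E ca1 st1 ex1]]; case: alt2 => [[g2lt ->]|[g2E ca2 st2 ex2]].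
(* Both velocities vanish, and the sign factor has modulus at most 1. *)
- rewrite !subr0 normr0 add0r; apply: le_trans BR; rewrite ler_pM2l //.
  apply: le_trans AB; apply: (le_trans (ler_norm _)); rewrite normrM.
  by rewrite ler_piMl // normr_sg; case: (_ != _).
(* Here [g1 < 1 = g2], so the sign is [-1]; stationarity removes the derivative of [g2], and [speed]
   supplies the second right-hand side, from which the first is subtracted. *)
- rewrite st2 subr0 sub0r normrN subr0 g2E ltr0_sg ?subr_lt0 // mulN1r.
  have s2 := speed _ _ _ _ ca2 ex2.
  apply: le_trans BR; apply: (le_trans (lerD s2 (lexx _))).
  rewrite -mulrDr ler_pM2l //; apply: le_trans AB.
  by rewrite distrC (le_trans _ (ler_norm _)) // addrC.
- rewrite st1 subr0 sub0r subr0 g1E gtr0_sg ?subr_gt0 // mul1r.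
  have s1 := speed _ _ _ _ ca1 ex1.
  apply: le_trans BR; apply: (le_trans (lerD s1 (lexx _))).
  rewrite -mulrDr ler_pM2l //; apply: le_trans AB.
  exact: ler_norm.
(* Both constraints are active: stationarity cancels the derivative term, leaving only the distance
   of the two normal velocities. *)
- rewrite st1 st2 subrr !mulr0 addr0.
  case: ex1 => m1 [_ -> E1]; case: ex2 => m2 [_ -> E2].
  apply: (le_trans (dist_normal_components Hip _ _ _ _ _ _ _ _ _ _ c_gt0 ca1 ca2 aK E1 E2)).
  rewrite -[X in _ <= _ + X]mulrA -!mulrDr ler_pM2l //.
  have e1 : `|a1 - a2| * (2 * `|du1| + `|om1| / c) <=
      C0 * dl * (2 * `|du1| + K1 * nw1 / c).
    apply: ler_pM => //; first by rewrite addr_ge0 ?mulr_ge0 ?invr_ge0 // ltW.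
    by rewrite lerD2l ler_wpM2r // ltW.
  apply: (@le_trans _ _ (K0 * `|du1 - du2| + (K1 * nw12 + C1 * nw1 * dl) +
      C0 * dl * (2 * `|du1| + K1 * nw1 / c))).
    by apply: lerD => //; rewrite lerD2l.
  by rewrite le_eqVlt; apply/orP; left; apply/eqP; ring.
Qed.

End rate_estimate.

(** * Almost-everywhere statements and the conclusion *)

Lemma lebesgue_ae_filter (R : realType) : Filter (nbhs (almost_everywhere (@lebesgue_measure R))).
Proof. exact: ae_filter_ringOfSetsType. Qed.

Lemma ae_derive1 {R : realType} {V : normedModType R} (T : R) (f : R -> V) : W11 T f ->
  {ae (@lebesgue_measure R), forall t, t \in `]0, T[ -> is_derive t 1 f (derive1 f t)}.
Proof.
move=> [_]; apply: (filterS (Filter := lebesgue_ae_filter R)) => t fd /fd tf.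
by rewrite derive1E; exact: derivableP.
Qed.

(** The exceptional points are the simple zeros of [f], a countable and hence null set. This
    supplies the side condition of [is_derive_abs] at almost every [t]. *)
Lemma ae_derive_eq0_at_zeros {R : realType} (f : R -> R) :
  {ae (@lebesgue_measure R), forall t, forall l : R, is_derive (t : R) 1 f l -> f t = 0 -> l = 0}.
Proof.
have neg : (@lebesgue_measure R).-negligible
    [set t | f t = 0 /\ exists2 l, l != 0 & is_derive t 1 f l].
  have cS := countable_simple_zeros f.
  apply/negligibleP; first exact: countable_measurable.
  exact: countable_lebesgue_measure0.
apply: negligibleS neg => t /existsNP[l] /not_implyP[fl] /not_implyP[ft /eqP l0].
by split=> //; exists l.
Qed.

Theorem theorem3p4 (R : realType)
  (X : completeNormedModType R) (ip : X -> X -> R) (Hip : inner_product ip)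
  (W : completeNormedModType R)
  (G : X -> W -> R) (HG0 : forall x w, 0 <= G x w) (HGloc : locally_lipschitz2 G)
  (gx : X -> W -> X) (Hgx : is_grad_x ip G gx)
  (gw : X -> W -> W -> R) (Hgw : is_grad_w G gw)
  (* hypothesis (H) *)
  (lambda c L : R) (Hlambda : 0 < lambda) (Hc : 0 < c) (HL : 0 < L)
  (mu1 : W -> R -> R) (mu2 : R -> R)
  (Hmu1pos : forall w s, 0 <= s -> 0 <= mu1 w s)
  (Hmu2pos : forall s, 0 <= s -> 0 <= mu2 s)
  (Hmu10 : forall w, mu1 w 0 = 0) (Hmu20 : mu2 0 = 0)
  (Hmu1oo : forall w, mu1 w x @[x --> +oo] --> +oo)
  (Hmu2oo : mu2 x @[x --> +oo] --> +oo)
  (HHi : forall x w, G x w = 1 -> c <= `|gx x w|)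
  (HHii : forall x y w, Zset G w x -> Zset G w y ->
            `|gx x w - gx y w| <= mu1 w `|x - y|)
  (HHiii : forall x z w, bdry (Zset G w) x -> Zset G w z ->
            - lambda * `|x - z| ^+ 2 <= ip (gx x w - gx z w) (x - z))
  (HHiv : forall x w w', `|G x w - G x w'| <= L * `|w - w'|)
  (HHv : forall x w rho, 0 < rho -> (rho%:E <= dist_set x (Zset G w))%E ->
            mu2 rho <= G x w - 1)
  (* hypothesis (L) *)
  (K0 K1 C0 C1 : R) (HK0 : 0 < K0) (HK1 : 0 < K1) (HC0 : 0 < C0) (HC1 : 0 < C1)
  (HLK0 : forall x w, `|gx x w| <= K0)
  (HLK1 : forall x w, dual_norm_le (gw x w) K1)
  (HLC0 : forall x w x' w', `|gx x w - gx x' w'| <= C0 * (`|x - x'| + `|w - w'|))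
  (HLC1 : forall x w x' w',
            dual_norm_le (fun v => gw x w v - gw x' w' v) (C1 * (`|x - x'| + `|w - w'|)))
  (* data *)
  (T : R) (HT : 0 < T)
  (u1 u2 : R -> X) (w1 w2 : R -> W) (x10 x20 : X) (xi1 xi2 : R -> X)
  (Hu1 : W11 T u1) (Hu2 : W11 T u2) (Hw1 : W11 T w1) (Hw2 : W11 T w2)
  (Hx10 : Zset G (w1 0) x10) (Hx20 : Zset G (w2 0) x20)
  (Hxi1 : sweeping_solution ip G (c / lambda) T u1 w1 x10 xi1)
  (Hxi2 : sweeping_solution ip G (c / lambda) T u2 w2 x20 xi2) :
  {ae (@lebesgue_measure R), forall t, t \in `]0, T[ ->
    let g := fun s => `|G (u1 s - xi1 s) (w1 s) - G (u2 s - xi2 s) (w2 s)| in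
    derivable g t 1 /\
    `|derive1 xi1 t - derive1 xi2 t| + c^-1 * derive1 g t
      <= c^-1 * (K0 * `|derive1 u1 t - derive1 u2 t|
                 + K1 * `|derive1 w1 t - derive1 w2 t|)
         + c^-1 * (2 * C0 * `|derive1 u1 t| + (C1 + C0 * K1 / c) * `|derive1 w1 t|)
           * (`|w1 t - w2 t| + `|(u1 t - xi1 t) - (u2 t - xi2 t)|)}.
Proof.
case: Hxi1 => Wxi1 Z1 N1 _; case: Hxi2 => Wxi2 Z2 N2 _.
pose f s := G (u1 s - xi1 s) (w1 s) - G (u2 s - xi2 s) (w2 s).
have S := ae_derive_eq0_at_zeros f.
have [Du1 Du2 Dw1 Dw2] := And4 (ae_derive1 T u1 Hu1) (ae_derive1 T u2 Hu2)
  (ae_derive1 T w1 Hw1) (ae_derive1 T w2 Hw2).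
have [Dxi1 Dxi2] := conj (ae_derive1 T xi1 Wxi1) (ae_derive1 T xi2 Wxi2).
have FF := lebesgue_ae_filter R.
near=> t.
move=> t0T; set g := (X in derivable X _ _).
have d_u1 : is_derive t 1 u1 (derive1 u1 t) by move: t0T; near: t; exact: Du1.
have d_u2 : is_derive t 1 u2 (derive1 u2 t) by move: t0T; near: t; exact: Du2.
have d_w1 : is_derive t 1 w1 (derive1 w1 t) by move: t0T; near: t; exact: Dw1.
have d_w2 : is_derive t 1 w2 (derive1 w2 t) by move: t0T; near: t; exact: Dw2.
have d_xi1 : is_derive t 1 xi1 (derive1 xi1 t) by move: t0T; near: t; exact: Dxi1.
have d_xi2 : is_derive t 1 xi2 (derive1 xi2 t) by move: t0T; near: t; exact: Dxi2.
have n1 : forall z, G z (w1 t) <= 1 -> 0 <= ip (u1 t - xi1 t - z) (derive1 xi1 t)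
    + `|derive1 xi1 t| / (2 * (c / lambda)) * `|u1 t - xi1 t - z| ^+ 2.
  by move: t0T; near: t; exact: N1.
have n2 : forall z, G z (w2 t) <= 1 -> 0 <= ip (u2 t - xi2 t - z) (derive1 xi2 t)
    + `|derive1 xi2 t| / (2 * (c / lambda)) * `|u2 t - xi2 t - z| ^+ 2.
  by move: t0T; near: t; exact: N2.
have sz : forall l, is_derive t 1 f l -> f t = 0 -> l = 0 by near: t; exact: S.
(* Since [t] is interior to [[0, T]], the constraint holds on both sides of [t], as two-sided
   maximality demands. *)
have near_le1 (u xi : R -> X) (w : R -> W) :
    (forall t, t \in `[0, T] -> Zset G (w t) (u t - xi t)) ->
    \forall s \near t, G (u s - xi s) (w s) <= 1.
  move=> Z; apply: filterS (near_in_itvoo t0T) => s s0T; apply: Z.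
  exact: subset_itv_oo_cc.
have alt1 := sweeping_velocity Hip Hgx Hgw (ltW HC0) (ltW HC1) HLC0 HLC1 Hc HHi
  _ _ _ _ _ _ _ _ d_u1 d_xi1 d_w1 (near_le1 _ _ _ Z1) n1.
have alt2 := sweeping_velocity Hip Hgx Hgw (ltW HC0) (ltW HC1) HLC0 HLC1 Hc HHi
  _ _ _ _ _ _ _ _ d_u2 d_xi2 d_w2 (near_le1 _ _ _ Z2) n2.
have dG1 := is_derive_grad Hip Hgx Hgw (ltW HC0) (ltW HC1) HLC0 HLC1
  (is_deriveB d_u1 d_xi1) d_w1.
have dG2 := is_derive_grad Hip Hgx Hgw (ltW HC0) (ltW HC1) HLC0 HLC1
  (is_deriveB d_u2 d_xi2) d_w2.
have df := is_deriveB dG1 dG2.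
have dg := is_derive_abs f _ _ df (sz _ df).
split; first by case: dg.
rewrite (derive1E g) (@derive_val _ _ _ _ _ _ _ dg).
pose x1 := u1 t - xi1 t; pose x2 := u2 t - xi2 t.
have aC := HLC0 x1 (w1 t) x2 (w2 t).
have omC := HLC1 x1 (w1 t) x2 (w2 t) (derive1 w1 t).
have omK := HLK1 x2 (w2 t) (derive1 w1 t - derive1 w2 t).
(* The parameter [dl] of the rate estimate is [|w1 t - w2 t| + |x1 - x2|], in this order. *)
rewrite (addrC `|x1 - x2|) in aC omC.
rewrite (dual_elemB (proj1 (Hgw x2 (w2 t)))) in omK.
by apply: (sweeping_rate_estimate Hip Hc (ltW HK1) (ltW HC0) _ _ _ _ _ _ _ _ _ _ _ _ _ _ _
  (HLK0 _ _) aC (HLK1 _ _ _) omC omK alt1 alt2); rewrite ?addr_ge0.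
Unshelve. all: by end_near. Qed.
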